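(* Let $m\geq 1$ be an integer, let $(S,d)$ be a separable metric space and let $(X_i)_{i\in\mathbb Z}=(X_0\circ T^i)_{i\in\mathbb Z}$ be a strictly stationary sequence with values in $S$. Suppose that the measurable function $h\colon S^m\to\mathbb R$ satisfies the following assumptions: (1) $h$ is symmetric, that is, $h(x_{\sigma(1)},\dots,x_{\sigma(m)})=h(x_1,\dots,x_m)$ for all $x_1,\dots,x_m\in S$ and each bijection $\sigma\colon\{1,\dots,m\}\to\{1,\dots,m\}$; (2) $h$ is bounded; (3) for almost every $\omega\in\Omega$, $I_m(S,\mathbf 1_{D(h)},\omega)=0$, where $D(h)\subset S^m$ denotes the set of discontinuity points of $h$. Then for almost every $\omega\in\Omega$, $$\lim_{n\to\infty}U_{m,n,h}(\omega)=I_m(S,h,\omega).$$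
   Context: $(\Omega,\mathcal F,\mathbb P)$ is a probability space and $T\colon\Omega\to\Omega$ is a measure-preserving map (invertible with measurable inverse, so that $T^i$ makes sense for all $i\in\mathbb Z$). $X_0\colon\Omega\to S$ is measurable for the Borel $\sigma$-algebra $\mathcal B(S)$ and $X_i=X_0\circ T^i$. No ergodicity is assumed. For $n\geq m$, the $U$-statistic of order $m$ with kernel $h$ is $$U_{m,n,h}=\frac1{\binom nm}\sum_{1\leq i_1<i_2<\dots<i_m\leq n}h(X_{i_1},\dots,X_{i_m}).$$ $\mathcal I$ denotes the $\sigma$-algebra of invariant sets, i.e. the sets $E\in\mathcal F$ such that $T^{-1}E=E$. The random probability measure $\mu_\omega$ on $\mathcal B(S)$ is defined by $\mu_\omega(A)=\mathbb E[\mathbf 1_{X_0\in A}\mid\mathcal I](\omega)$, $A\in\mathcal B(S)$ (a regular conditional distribution of $X_0$ given $\mathcal I$). For a function $g\colon S^m\to\mathbb R$, $$I_m(S,g,\omega)=\int_{S^m}g(x_1,\dots,x_m)\,d\mu_\omega(x_1)\cdots d\mu_\omega(x_m).$$ *)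

(* Defs.v *)
From HB Require Import structures.
From mathcomp Require Import all_boot all_order all_algebra.
From mathcomp Require Import all_classical all_reals all_analysis.
From mathcomp Require Import measurable_realfun.

Set Implicit Arguments.
Unset Strict Implicit.
Unset Printing Implicit Defensive.

Import Order.TTheory GRing.Theory Num.Theory.
Import numFieldNormedType.Exports.

Local Open Scope classical_set_scope.
Local Open Scope ring_scope.

Definition separable (S : topologicalType) : Prop :=
  exists2 D : set S, countable D & dense D.

(* measurableType requires a pointed carrier; this only says S is nonempty. *)
#[short(type="pmetricType")]
HB.structure Definition PointedMetric (K : numDomainType) :=
  {M of Metric K M & Pointed M}.

Definition borel (S : ptopologicalType) := g_sigma_algebraType (@open S).

(* S ^ m with the product topology. For S separable metric its Borel
   sigma-algebra [borel (power m S)] is the product sigma-algebra. *)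
Definition power (m : nat) (S : ptopologicalType) := {ptws 'I_m -> S}.

Section power_instances.
Variables (m : nat) (S : ptopologicalType).
HB.instance Definition _ := Topological.copy (power m S) {ptws 'I_m -> S}.
HB.instance Definition _ := isPointed.Build (power m S) (fun=> point).
End power_instances.

Section dynamics.
Context d (Omega : measurableType d) (R : realType).
Implicit Types (P : probability Omega R) (T : Omega -> Omega).

Definition mp_automorphism P T (T' : Omega -> Omega) : Prop :=
  [/\ cancel T T', cancel T' T,
      measurable_fun [set: Omega] T, measurable_fun [set: Omega] T' &
      forall A, measurable A -> P (T @^-1` A) = P A].

(* T ^ i for i in Z, where T' is the inverse of T *)
Definition iterz T (T' : Omega -> Omega) (i : int) : Omega -> Omega :=
  match i with
  | Posz n => iter n T
  | Negz n => iter n.+1 T'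
  end.

Definition invariant_sets T : set (set Omega) :=
  [set E | measurable E /\ T @^-1` E = E].

Definition is_cond_expectation P (G : set (set Omega)) (Y Z : Omega -> \bar R)
    : Prop :=
  [/\ P.-integrable [set: Omega] Z,
      forall B : set (\bar R), measurable B -> G (Z @^-1` B) &
      forall E, G E -> \int[P]_(w in E) Z w = \int[P]_(w in E) Y w]%E.

Definition is_regular_cond_distribution P (G : set (set Omega)) (S : ptopologicalType)
    (X : Omega -> S) (mu : Omega -> probability (borel S) R) : Prop :=
  forall A : set (borel S), measurable A ->
    is_cond_expectation P G (fun w => (\1_(X @^-1` A) w)%:E) (fun w => mu w A).

End dynamics.

(* The indices i_1 < ... < i_m in {1, ..., n} are encoded as the increasing
   maps i from 'I_m to 'I_n, shifted by one. *)
Definition Ustat (R : realType) (Omega S : Type) (m n : nat)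
    (h : ('I_m -> S) -> R) (X : int -> Omega -> S) (w : Omega) : R :=
  ('C(n, m)%:R)^-1 *
  \sum_(i : {ffun 'I_m -> 'I_n} |
         [forall k : 'I_m, forall l : 'I_m, (k < l)%N ==> (i k < i l)%N])
    h (fun k => X ((i k).+1%:Z) w).

Section iterated_integral.
Context (R : realType) (S : ptopologicalType).
Variable mu : {measure set (borel S) -> \bar R}.
Local Open Scope ereal_scope.

Fixpoint tuple_integral (m : nat) : (m.-tuple S -> \bar R) -> \bar R :=
  match m with
  | 0%N => fun g => g [tuple]
  | p.+1 => fun g =>
      \int[mu]_(x in [set: borel S]) tuple_integral (fun t : p.-tuple S => g [tuple of x :: t])
  end.

(* The integral of g (x_1, ..., x_m) d mu(x_1) ... d mu(x_m), as an iterated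
   integral; for bounded Borel g on a separable metric space it is the integral
   of g against the m-fold product measure of mu. *)
Definition multi_integral (m : nat) (g : ('I_m -> S) -> \bar R) : \bar R :=
  tuple_integral (fun t : m.-tuple S => g (tnth t)).

End iterated_integral.

Definition discontinuity_set (R : realType) (m : nat) (S : ptopologicalType)
    (h : power m S -> R) : set (power m S) :=
  [set x | ~ {for x, continuous h}].

(* Main.v *)
Require Import Defs.
From HB Require Import structures.
From mathcomp Require Import all_boot all_order all_algebra all_fingroup.
From mathcomp Require Import all_classical all_reals all_analysis.
From mathcomp Require Import measurable_realfun.
From mathcomp Require Import zify ring lra.

Set Implicit Arguments.
Unset Strict Implicit.
Unset Printing Implicit Defensive.

Import Order.TTheory GRing.Theory Num.Theory.
Import numFieldNormedType.Exports.

Local Open Scope classical_set_scope.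
Local Open Scope ring_scope.

(** The random measure [mu w] is the almost sure limit of the empirical measures
    of X_1 w, X_2 w, ..., in the following sense: for each Borel set A, the
    proportion of the i <= n with X_i w in A tends to [mu w A] for almost every
    w. This is Birkhoff's theorem for an indicator function
    ([ae_cvg_frequency]); it follows from a maximal inequality
    ([maximal_ergodic]), applied on the invariant set where the maxima of the
    ergodic sums of 1_A(X_i) - mu(A) - e are unbounded
    ([ergodic_upper_bound]).

    Since S has a countable base B_0, B_1, ..., it suffices to use countably
    many Borel sets. The first k base sets cut S into at most 2 ^ k cells, and
    one null set can be discarded outside of which the frequencies of all cells
    of all these partitions converge. From here on, w is fixed and no
    probability remains.

    The kernel h is squeezed between its infimum and its supremum over the
    products of cells. Both bounds are constant on each of the finitely many
    products of cells, so for them the averages over all m-tuples of indices (the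
    V-statistics) are polynomials in the cell frequencies and converge to the
    corresponding iterated integrals ([Vstat_cell_fun_cvg]). The gap between the
    two bounds decreases with k, and tends to 0 at each point of continuity of h
    because the cells shrink to neighbourhoods ([nbhs_box]); hence its limit is
    dominated by a multiple of the indicator of D(h), whose iterated integral
    vanishes, and the iterated integral of the gap tends to 0
    ([multi_integral_osc_cvg0]). This gives the convergence of the V-statistics
    of h ([Vstat_cvg]).

    By symmetry of h, the U-statistic is the average of h over the injective
    maps from indices to indices ([Ustat_injective]), and as n grows almost all
    maps are injective, so the U- and V-statistics are asymptotically equal
    ([Ustat_Vstat_bound], [cvg_ffact_exp]). *)

(** * The maximal ergodic inequality *)

Section maximal_ergodic.
Context d (Omega : measurableType d) (R : realType) (P : probability Omega R).
Variable T : Omega -> Omega.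
Hypothesis mT : measurable_fun [set: Omega] T.
Hypothesis PT : forall A, measurable A -> P (T @^-1` A) = P A.
Implicit Types (g Y : Omega -> R) (E : set Omega).

Lemma ge0_integral_invariant E (F : Omega -> \bar R) : invariant_sets T E ->
  measurable_fun [set: Omega] F -> (forall w, 0 <= F w)%E ->
  (\int[P]_(w in E) F (T w) = \int[P]_(w in E) F w)%E.
Proof.
move=> [mE TE] mF F0; rewrite -[in LHS]TE -(ge0_integral_pushforward mT)//.
- by apply: eq_measure_integral => A mA _; exact: PT.
- exact: measurable_funTS.
Qed.

(** The maximum of 0 and of the ergodic sums of g of length at most n. The
    recursion M_{n+1} = max (0, g + M_n o T) is the form in which these maxima
    enter the maximal inequality. *)
Fixpoint maxsum g (n : nat) (w : Omega) : R :=
  if n is p.+1 then Num.max 0 (g w + maxsum g p (T w)) else 0.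

Lemma maxsum_ge0 g n w : 0 <= maxsum g n w.
Proof. by case: n => //= n; rewrite le_max lexx. Qed.

Lemma le_maxsumS g n w : maxsum g n w <= maxsum g n.+1 w.
Proof.
elim: n w => [|n IH] w; first exact: maxsum_ge0.
by rewrite [leLHS]/= [leRHS]/= le_max2 // lerD2l.
Qed.

Lemma le_maxsum g w : {homo maxsum g ^~ w : m n / (m <= n)%N >-> m <= n}.
Proof. by apply: homo_leq => // [|n]; [exact: le_trans|exact: le_maxsumS]. Qed.

Lemma sum_le_maxsum g n w : \sum_(i < n) g (iter i T w) <= maxsum g n w.
Proof.
elim: n w => [|n IH] w; first by rewrite big_ord0.
rewrite big_ord_recl /= le_max lerD2l; apply/orP; right.
by under eq_bigr do rewrite -iterS iterSr; exact: IH.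
Qed.

Lemma maxsum_le g C n w : (forall w, `|g w| <= C) -> maxsum g n w <= n%:R * C.
Proof.
move=> gC; have C0 : 0 <= C by exact: le_trans (gC w).
elim: n w => [|n IH] w; first by rewrite mul0r.
rewrite ge_max mulr_ge0//= -natr1 mulrDl mul1r addrC lerD//.
exact: le_trans (ler_norm _) _.
Qed.

Lemma measurable_maxsum g n : measurable_fun [set: Omega] g ->
  measurable_fun [set: Omega] (maxsum g n).
Proof.
move=> mg; elim: n => [|n IH] /=; first exact: measurable_cst.
apply: measurable_maxr; first exact: measurable_cst.
by apply: measurable_funD => //; exact: measurableT_comp.
Qed.

(** On this set the ergodic sums of g have infinite supremum. Contrary to the set
    where some ergodic sum is positive, it is exactly invariant: passing from w
    to T w changes the ergodic sums by the finite amount g w. *)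
Definition unbounded_set g : set Omega :=
  [set w | forall K : nat, exists n, K%:R < maxsum g n w].

Lemma invariant_unbounded_set g : measurable_fun [set: Omega] g ->
  invariant_sets T (unbounded_set g).
Proof.
move=> mg; split.
  have -> : unbounded_set g =
      \bigcap_(K : nat) \bigcup_n [set w | K%:R < maxsum g n w].
    apply/seteqP; split => w /= Ew K; first by have [n] := Ew K; exists n.
    by have [n _] := Ew K I; exists n.
  apply: bigcapT_measurable => K; apply: bigcupT_measurable => n.
  rewrite -[X in measurable X]setTI.
  by apply: (measurable_fun_ltr (measurable_cst _) (measurable_maxsum _ mg)).
apply/seteqP; split => w /= Ew K.
- have [n] := Ew (Num.truncn (`|K%:R - g w|)).+1.
  move=> nK; exists n.+1 => /=; rewrite lt_max; apply/orP; right.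
  rewrite -ltrBlDl (le_lt_trans (ler_norm _))// (lt_trans _ nK)//.
  exact: truncnS_gt.
- have [n] := Ew (Num.truncn (K%:R + `|g w|)).+1.
  have h : K%:R + `|g w| < (Num.truncn (K%:R + `|g w|)).+1%:R by exact: truncnS_gt.
  move=> /(lt_trans h); case: n => [|n] /=.
    by rewrite ltNge addr_ge0.
  rewrite lt_max => /orP[|nK]; first by rewrite ltNge addr_ge0.
  by exists n; have := ler_norm (g w); lra.
Qed.

Lemma integrable_bounded E g (C : R) : measurable E -> measurable_fun [set: Omega] g ->
  (forall w, `|g w| <= C) -> P.-integrable E (EFin \o g).
Proof.
move=> mE mg gC; apply: measurable_bounded_integrable => //.
- by rewrite (le_lt_trans (probability_le1 _ mE))// ltry.
- exact: measurable_funTS.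
- by exists C; split; [exact: num_real|] => x Cx w _; exact: le_trans (gC w) (ltW Cx).
Qed.

(** A form of the maximal ergodic theorem. Let M_n be the maxima above and E the
    set where they are unbounded. As E is invariant, M_n and M_n o T have the
    same integral over E, so the integral over E of D_n = M_{n+1} - M_n o T
    is nonnegative because M_n increases with n. But D_n is the maximum of g and
    - M_n o T, which is bounded by |g| and equals g for large n on E. Dominated
    convergence concludes. *)
Lemma maximal_ergodic g (C : R) : measurable_fun [set: Omega] g ->
  (forall w, `|g w| <= C) ->
  (0 <= \int[P]_(w in unbounded_set g) (g w)%:E)%E.
Proof.
move=> mg gC; set E := unbounded_set g.
have [mE TE] : invariant_sets T E := invariant_unbounded_set mg.
have mM n : measurable_fun [set: Omega] (maxsum g n) by exact: measurable_maxsum.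
have MC n w : `|maxsum g n w| <= n%:R * C.
  by rewrite ger0_norm ?maxsum_ge0//; exact: maxsum_le.
pose D n w := maxsum g n.+1 w - maxsum g n (T w).
have mD n : measurable_fun [set: Omega] (D n).
  by apply: measurable_funB => //; exact: measurableT_comp.
have Dg n w : `|D n w| <= `|g w|.
  rewrite /D /=; have := maxsum_ge0 g n (T w); move: (maxsum _ _ _) => M M0.
  have := ler_norm (g w); have := ler_norm (- g w); rewrite normrN ler_norml.
  by rewrite /Num.max; case: ifPn; rewrite -?leNgt; lra.
have D_ge0 n : (0 <= \int[P]_(w in E) (D n w)%:E)%E.
  have iM k : P.-integrable E (EFin \o maxsum g k).
    exact: (integrable_bounded mE (mM k) (MC k)).
  have iMT k : P.-integrable E (EFin \o (maxsum g k \o T)).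
    apply: (@integrable_bounded _ _ (k%:R * C)) => //; last by move=> w; exact: MC.
    exact: measurableT_comp.
  under eq_integral do rewrite EFinB.
  rewrite (integralB_EFin mE (iM n.+1) (iMT n)) /=.
  rewrite (@ge0_integral_invariant E (EFin \o maxsum g n))//; last 2 first.
  - exact/measurable_EFinP.
  - by move=> w; rewrite lee_fin maxsum_ge0.
  rewrite sube_ge0; last by rewrite (integrable_fin_num mE (iM n)).
  apply: ge0_le_integral => //.
  - by move=> w _; rewrite lee_fin maxsum_ge0.
  - exact/measurable_EFinP/measurable_funTS/(mM n).
  - exact/measurable_EFinP/measurable_funTS/(mM n.+1).
  - by move=> w _; rewrite lee_fin; exact: le_maxsumS.
have Dcvg w : E w -> (D n w)%:E @[n --> \oo] --> (g w)%:E.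
  rewrite -TE => Ew; have [N NK] := Ew (Num.truncn `|g w|).+1.
  apply: cvg_near_cst; exists N => // n /= Nn; congr EFin.
  have : `|g w| < maxsum g n (T w).
    apply: lt_le_trans (le_maxsum g (T w) Nn); apply: lt_trans NK.
    exact: truncnS_gt.
  have := ler_norm (- g w); rewrite normrN /D /= => h1 h2.
  by rewrite max_r; lra.
have [_ _] := @dominated_convergence _ _ _ P E mE (fun n w => (D n w)%:E)
  (EFin \o g) (EFin \o (fun w => `|g w|))
  (fun n => measurable_funTS ((measurable_EFinP _ _).2 (mD n)))
  (measurable_funTS ((measurable_EFinP _ _).2 mg))
  (aeW P Dcvg)
  (integrable_norm (integrable_bounded mE mg gC))
  (aeW P (fun w n _ => Dg n w)).
by apply: cvge_ge; exact: nearW.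
Qed.

(** The upper half of Birkhoff's theorem. Apply the maximal inequality to
    g = f - Y - e on the invariant set E where its ergodic sums are unbounded:
    f and Y have the same integral over E, so - e P(E) >= 0 and E is null.
    Outside of E the ergodic sums of g are bounded by a constant K. *)
Lemma ergodic_upper_bound (f Y : Omega -> R) (C e : R) : measurable_fun [set: Omega] f ->
  measurable_fun [set: Omega] Y ->
  (forall w, `|f w| <= C) -> (forall w, `|Y w| <= C) -> (forall w, Y (T w) = Y w) ->
  (forall E, invariant_sets T E ->
     (\int[P]_(w in E) (f w)%:E = \int[P]_(w in E) (Y w)%:E)%E) ->
  0 < e ->
  {ae P, forall w, exists K : nat, forall n : nat,
    \sum_(i < n) f (iter i T w) <= n%:R * (Y w + e) + K%:R}.
Proof.
move=> mf mY fC YC YT fY e0.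
pose g w := f w - (Y w + e).
have mg : measurable_fun [set: Omega] g.
  by apply: measurable_funB => //; exact: measurable_funD.
have gC w : `|g w| <= C + (C + `|e|).
  by rewrite (le_trans (ler_normB _ _))// lerD// (le_trans (ler_normD _ _))// lerD.
have [mE TE] : invariant_sets T (unbounded_set g) := invariant_unbounded_set mg.
exists (unbounded_set g); split => //.
- have := maximal_ergodic mg gC.
  have -> : (\int[P]_(w in unbounded_set g) (g w)%:E = - (e%:E * P (unbounded_set g)))%E.
    under eq_integral do rewrite EFinB.
    rewrite (integralB_EFin mE); last 2 first.
    + exact: (integrable_bounded mE mf fC).
    + apply: (@integrable_bounded _ _ (C + `|e|)) => //; first exact: measurable_funD.
      by move=> w; rewrite (le_trans (ler_normD _ _))// lerD.
    under [X in (_ - X)%E]eq_integral do rewrite EFinD.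
    rewrite (integralD_EFin mE (f2 := cst e)); last 2 first.
    + exact: (integrable_bounded mE mY YC).
    + exact: (@integrable_bounded _ (cst e) `|e|).
    have -> : (\int[P]_(w in unbounded_set g) (cst e w)%:E = e%:E * P (unbounded_set g))%E.
      exact: (integral_cst P mE e%:E).
    have Yfin := integrable_fin_num mE (integrable_bounded mE mY YC).
    by rewrite fY// fin_num_oppeD ?fin_numM ?fin_num_measure// addeA subee ?add0e.
  rewrite oppe_ge0 pmule_rle0 ?lte_fin// => PE.
  by apply/eqP; rewrite eq_le PE measure_ge0.
- move=> w /= NK; apply: contrapT => Nu; apply: NK.
  move/existsNP : Nu => [K Kn]; exists K => n.
  have {}Kn : maxsum g n w <= K%:R by rewrite leNgt; apply/negP => ?; apply: Kn; exists n.
  have Yi i : Y (iter i T w) = Y w by elim: i => //= i; rewrite YT.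
  have := le_trans (sum_le_maxsum g n w) Kn.
  rewrite (eq_bigr (fun i : 'I_n => f (iter i T w) - (Y w + e))); last first.
    by move=> i _; rewrite /g Yi.
  rewrite sumrB sumr_const card_ord -mulr_natl; lra.
Qed.

End maximal_ergodic.

(** * Almost sure convergence of empirical frequencies *)

Definition frequency (R : realType) (S : Type) (x : nat -> S) (A : set S) (n : nat) : R :=
  n%:R^-1 * \sum_(i < n) \1_A (x i).

Section empirical_frequencies.
Context (R : realType) d (Omega : measurableType d) (P : probability Omega R).

Lemma cvg_mean (s : nat -> R) (y : R) :
  (forall k : nat, exists K : nat, forall n : nat,
     s n <= n%:R * (y + k.+1%:R^-1) + K%:R) ->
  (forall k : nat, exists K : nat, forall n : nat,
     n%:R * (y - k.+1%:R^-1) - K%:R <= s n) ->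
  n%:R^-1 * s n @[n --> \oo] --> y.
Proof.
move=> sy ys; apply/cvgrPdist_le => e e0.
have [k ke] : exists k : nat, k.+1%:R^-1 <= e / 2.
  exists (Num.truncn (e / 2)^-1); rewrite -[leRHS]invrK lef_pV2 ?posrE ?invr_gt0 ?divr_gt0//.
  exact/ltW/truncnS_gt.
have [K1 sK] := sy k; have [K2 Ks] := ys k.
near=> n.
have n0 : 0 < n%:R :> R by near: n; exact: nbhs_infty_gtr.
have nK : K1%:R + K2%:R <= n%:R * (e / 2).
  by rewrite -ler_pdivrMr ?divr_gt0//; near: n; exact: nbhs_infty_ger.
have {sK}sK := sK n; have {Ks}Ks := Ks n.
have nke := ler_wpM2l (ltW n0) ke.
have K1_ge0 : 0 <= K1%:R :> R by [].
have K2_ge0 : 0 <= K2%:R :> R by [].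
have -> : y - n%:R^-1 * s n = n%:R^-1 * (n%:R * y - s n).
  by rewrite mulrBr mulKf// gt_eqF.
rewrite normrM gtr0_norm ?invr_gt0// ler_pdivrMl// ler_norml.
(* The products are made atoms: the rest is linear in them. *)
move: sK Ks; rewrite mulrDr mulrBr.
move: (n%:R * y) (n%:R / k.+1%:R) nK nke K1_ge0 K2_ge0 => a b; rewrite mulrA.
move: (n%:R * e) (K1%:R) (K2%:R) => c u v; lra.
Unshelve. all: by end_near. Qed.

(** The upper bound of Birkhoff's theorem is used for A and for its complement,
    and the latter gives the lower bound for A. The sum starts at X_1 rather
    than at X_0, so the function averaged is the indicator of X_1 in A; by
    invariance of P, it has the same conditional expectation mu(A) as the
    indicator of X_0 in A. *)
Lemma ae_cvg_frequency (T : Omega -> Omega) (S : ptopologicalType)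
    (X0 : Omega -> S) (mu : Omega -> probability (borel S) R) (A : set (borel S)) :
  measurable_fun [set: Omega] T ->
  (forall B, measurable B -> P (T @^-1` B) = P B) ->
  measurable_fun [set: Omega] (X0 : Omega -> borel S) ->
  is_regular_cond_distribution P (invariant_sets T) X0 mu ->
  measurable A ->
  {ae P, forall w, frequency R (fun i => X0 (iter i.+1 T w)) A n @[n --> \oo]
    --> fine (mu w A)}.
Proof.
move=> mT PT mX0 hmu.
have upper (B : set (borel S)) : measurable B -> forall k : nat,
    {ae P, forall w, exists K : nat, forall n : nat,
      \sum_(i < n) (\1_B (X0 (iter i.+1 T w)) : R)
        <= n%:R * (fine (mu w B) + k.+1%:R^-1) + K%:R}.
  move=> mB k.
  have [_ invB intB] := hmu B mB.
  have mXB : measurable (X0 @^-1` B) by rewrite -[X in measurable X]setTI; exact: mX0.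
  have mmuB : measurable_fun [set: Omega] (fun w => mu w B).
    by move=> _ C mC; rewrite setTI; have [] := invB _ mC.
  have fmuB w : mu w B \is a fin_num by exact: fin_num_measure.
  apply: (@ergodic_upper_bound _ _ _ P T mT PT
    (fun w => \1_(X0 @^-1` B) (T w)) (fun w => fine (mu w B)) 1).
  - by apply: measurableT_comp => //; exact: measurable_indic.
  - exact: measurableT_comp.
  - by move=> w; rewrite ger0_norm// indicE lern1 leq_b1.
  - move=> w; rewrite ger0_norm ?fine_ge0//.
    by rewrite -lee_fin fineK ?probability_le1.
  (* The level set of mu(B) through w is an invariant set. *)
  - move=> w; have [_] := invB [set mu w B] (emeasurable_set1 _).
    by move=> /seteqP[_ /(_ w erefl)] /= ->.
  - move=> E iE; under [RHS]eq_integral do rewrite fineK//.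
    rewrite intB//; apply: (ge0_integral_invariant mT PT (F := EFin \o \1_(X0 @^-1` B))) => //.
    + exact/measurable_EFinP/measurable_indic.
    + by move=> w; rewrite lee_fin indicE.
  - by rewrite invr_gt0.
move=> mA; have mCA : measurable (~` A) by exact: measurableC.
have /ae_foralln := upper _ mA; have /ae_foralln := upper _ mCA.
apply: filterS2 => w CAw Aw; apply: cvg_mean => // k.
have [K CAK] := CAw k; exists K => n; have := CAK n.
rewrite (eq_bigr (fun i : 'I_n => 1 - \1_A (X0 (iter i.+1 T w)))); last first.
  by move=> i _; rewrite !indicE in_setC; case: (_ \in _); rewrite ?subrr ?subr0.
rewrite sumrB sumr_const card_ord.
have -> : fine (mu w (~` A)) = 1 - fine (mu w A).
  rewrite probability_setC// -[in LHS](@fineK _ (mu w A)) ?fin_num_measure//.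
rewrite !mulrDr !mulrN mulr1; move: (_ * _) (_ / _) (bigop _ _ _) => a b c; lra.
Qed.

End empirical_frequencies.

(** * Cells generated by a countable base *)

Section cells.
Variable S : ptopologicalType.

Definition countable_base (B : nat -> set S) : Prop :=
  (forall i, open (B i)) /\
  forall x U, nbhs x U -> exists2 i, B i x & B i `<=` U.

Variable B : nat -> set S.
Hypothesis baseB : countable_base B.

(** The cell of x in the partition generated by B_0, ..., B_{k-1} is encoded by
    the truth values of x in B_i for i < k. *)
Definition cell (k : nat) (x : S) : {ffun 'I_k -> bool} :=
  [ffun i : 'I_k => `[< B i x >]].

Lemma measurable_cell k (a : {ffun 'I_k -> bool}) :
  measurable (cell k @^-1` [set a] : set (borel S)).
Proof.
have -> : cell k @^-1` [set a] =
    \bigcap_(i in [set: 'I_k]) (if a i then B i else ~` B i).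
  apply/seteqP; split => [x /= <- i _|x xa].
    by rewrite ffunE; case: asboolP.
  apply/ffunP => i; have := xa i I; rewrite ffunE.
  by case: (a i) => ?; apply/asboolP.
apply: fin_bigcap_measurable => // i _.
have mB : measurable (B i : set (borel S)) by apply: sub_sigma_algebra; exact: baseB.1.
by case: ifP => // _; exact: measurableC.
Qed.

Lemma cell_refine k l x y : (k <= l)%N -> cell l x = cell l y -> cell k x = cell k y.
Proof.
move=> kl /ffunP xy; apply/ffunP => i.
by have := xy (widen_ord kl i); rewrite !ffunE.
Qed.

Definition box (m k : nat) (x : power m S) : set (power m S) :=
  [set y | forall j, cell k (y j) = cell k (x j)].

(** The boxes around x decrease with k, so they generate a filter. That filter
    converges to x coordinatewise, because any neighbourhood of x_j contains
    some base set around x_j, hence the cells of x_j for large k; so it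
    converges to x in the product topology. *)
Lemma nbhs_box m (x : power m S) U : nbhs x U -> exists k, box k x `<=` U.
Proof.
pose F : set_system (power m S) := [set V | exists k, box k x `<=` V].
have FF : Filter F.
  split; first by exists 0%N.
  - move=> V W [k kV] [l lW]; exists (maxn k l) => y xy; split.
      by apply: kV => j; apply: cell_refine (xy j); exact: leq_maxl.
    by apply: lW => j; apply: cell_refine (xy j); exact: leq_maxr.
  - by move=> V W VW [k kV]; exists k; exact: subset_trans VW.
suff : F --> x by exact.
apply/cvg_sup => j V [_ [[W oW <-] /= Wxj WV]].
have [i Bi BiW] := baseB.2 (x j) W (open_nbhs_nbhs (conj oW Wxj)).
exists i.+1 => y /(_ j)/ffunP/(_ ord_max); rewrite !ffunE /= => yx.
apply: WV; apply: BiW; apply/asboolP.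
by move: yx; rewrite (asboolT Bi) => ->.
Qed.

End cells.

(** The base consists of the interiors of the balls of radius 1 / (j + 1)
    centred at the points of a countable dense set. *)
Lemma separable_countable_base (R : realType) (S : pmetricType R) :
  separable S -> exists B : nat -> set S, countable_base B.
Proof.
move=> [D cD dD].
have [x0 [_ Dx0]] := dD setT (ex_intro _ point I) openT.
have /pcard_surjP[e De] : (D #<= [set: nat])%card := cD.
pose B n : set S := if unpickle n is Some (i, j) then
  (ball (e i : S) (j.+1%:R^-1 : R))° else set0.
exists B; split.
  move=> n; rewrite /B; case: unpickle => [[i j]|]; [exact: open_interior|exact: open0].
move=> x U /nbhs_ballP[r /= r0 rU].
have [j jr] : exists j : nat, (j.+1%:R^-1 : R) <= r / 2.
  exists (Num.truncn (r / 2)^-1).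
  rewrite -[leRHS]invrK lef_pV2 ?posrE ?invr_gt0 ?divr_gt0//; exact/ltW/truncnS_gt.
pose t : R := j.+1%:R^-1; have t0 : 0 < t by rewrite invr_gt0.
have t20 : 0 < t / 2 by rewrite divr_gt0.
have [y [xy Dy]] := dD _ (ex_intro _ x (nbhsx_ballx x _ t20)) (@open_interior S _).
have [i _ eiy] := De y Dy; subst y.
have {}xy : ball x (t / 2) (e i) := interior_subset xy.
exists (pickle (i, j)); rewrite /B pickleK.
  apply/nbhs_ballP; exists (t / 2) => //= z xz.
  by rewrite -/t [t]splitr; apply: ball_triangle (ball_sym xy) xz.
apply: (subset_trans (@interior_subset _ _)) => z ez; apply: rU.
have : ball x (t / 2 + t) z by exact: ball_triangle xy ez.
apply: le_ball; move: jr; rewrite -/t; lra.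
Qed.

(** * Iterated integrals of functions of cells *)

Section iterated_integrals.
Context (R : realType).

(** The integral of a nonnegative function is a supremum over the simple functions
    below it, hence it is monotone on arbitrary functions; a general integral is
    the difference of the integrals of the positive and negative parts. This
    allows iterated integrals to be compared with no information on how an
    inner integral depends on the outer variables. *)
Lemma le_integral_nonmeas d (T : measurableType d) (mu : {measure set T -> \bar R})
    (f g : T -> \bar R) :
  (forall x, f x <= g x)%E -> (\int[mu]_x f x <= \int[mu]_x g x)%E.
Proof.
move=> fg.
have ge0_mono (u v : T -> \bar R) : (forall x, 0 <= u x)%E -> (forall x, u x <= v x)%E ->
    (\int[mu]_x u x <= \int[mu]_x v x)%E.
  move=> u0 uv; rewrite !ge0_integralTE//; last by move=> x; exact: le_trans (uv x).
  by apply: ereal_sup_le => _ [s su <-]; exists s => // x; exact: le_trans (uv x).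
rewrite [leLHS]integralE [leRHS]integralE; apply: leeB; apply: ge0_mono => // x.
- by apply: (@funepos_le _ _ setT) => //; rewrite ?inE.
- by apply: (@funeneg_le _ _ setT) => //; rewrite ?inE.
Qed.

Variable (S : ptopologicalType) (nu : probability (borel S) R).

Lemma le_tuple_integral m (f g : m.-tuple S -> \bar R) :
  (forall t, f t <= g t)%E -> (tuple_integral nu f <= tuple_integral nu g)%E.
Proof.
elim: m f g => [|m IH] f g fg /=; first exact: fg.
by apply: le_integral_nonmeas => x; apply: IH => t; exact: fg.
Qed.

Lemma tuple_integral_cst m (r : R) :
  tuple_integral nu (fun _ : m.-tuple S => r%:E) = r%:E.
Proof.
elim: m => //= m IH; under eq_integral do rewrite IH.
rewrite (integral_cst nu measurableT r%:E).
by rewrite [X in (_ * X)%E](probability_setT nu) mule1.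
Qed.

(** Here q sends a point to the label of its cell in a finite measurable
    partition of S. *)
Section cell_functions.
Variables (Q : finType) (q : S -> Q).
Hypothesis mq : forall a, measurable (q @^-1` [set a] : set (borel S)).

Lemma measurable_cell_fun d (U : measurableType d) (G : Q -> U) :
  measurable_fun [set: borel S] (G \o q).
Proof.
move=> _ V mV; rewrite setTI.
have -> : (G \o q) @^-1` V = \bigcup_(a in [set a | V (G a)]) (q @^-1` [set a]).
  by apply/seteqP; split => [x /= Vx|x [a /= Va qxa]]; [exists (q x)|rewrite /= qxa].
by apply: fin_bigcup_measurable => // a _; exact: mq.
Qed.

Definition cell_measure (a : Q) : R := fine (nu (q @^-1` [set a])).

Lemma integral_cell_fun (G : Q -> R) :
  (\int[nu]_x (G (q x))%:E = (\sum_a G a * cell_measure a)%:E)%E.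
Proof.
have GE x : (G (q x))%:E = (\sum_a (G a)%:E * (\1_(q @^-1` [set a]) x)%:E)%E.
  rewrite (bigD1 (q x))//= big1 ?adde0 => [|a aqx].
    by rewrite indicE mem_set// mule1.
  by rewrite indicE memNset ?mule0// => /= /esym/eqP; rewrite (negPf aqx).
have iq a : nu.-integrable [set: borel S] (EFin \o \1_(q @^-1` [set a])).
  exact: integrable_indic.
under eq_integral do rewrite GE.
rewrite integral_sum//=; last by move=> a; exact: (integrableZl measurableT _ (iq a)).
rewrite -sumEFin; apply: eq_bigr => a _; rewrite (integralZl measurableT (iq a))/=.
rewrite (integral_indic nu measurableT (mq a)) setIT EFinM fineK//.
exact: fin_num_measure.
Qed.

Lemma map_tuple_cons m x (t : m.-tuple S) :
  map_tuple q [tuple of x :: t] = [tuple of q x :: map_tuple q t].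
Proof. exact: val_inj. Qed.

Lemma sum_tupleS m (F : m.+1.-tuple Q -> R) :
  \sum_p F p = \sum_a \sum_(p : m.-tuple Q) F [tuple of a :: p].
Proof.
rewrite pair_big /= (reindex (fun ap : Q * m.-tuple Q => [tuple of ap.1 :: ap.2]))//.
exists (fun p => (thead p, [tuple of behead p])) => [[a p] _|p _] /=.
  by rewrite theadE; congr pair; exact: val_inj.
by rewrite -tuple_eta.
Qed.

Lemma tuple_integral_cell_fun m (c : m.-tuple Q -> R) :
  tuple_integral nu (fun t => (c (map_tuple q t))%:E) =
  (\sum_p c p * \prod_j cell_measure (tnth p j))%:E.
Proof.
elim: m c => [|m IH] c /=.
  rewrite (big_pred1 [tuple]) => [|p]; last by rewrite /= [p]tuple0; exact/esym/eqP.
  by rewrite big_ord0 mulr1 [map_tuple _ _]tuple0.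
pose G a := \sum_(p : m.-tuple Q) c [tuple of a :: p] * \prod_j cell_measure (tnth p j).
transitivity (\int[nu]_x (G (q x))%:E)%E.
  apply: eq_integral => x _; rewrite -IH; congr (tuple_integral _ _).
  by apply/funext => t; rewrite map_tuple_cons.
rewrite integral_cell_fun sum_tupleS; congr EFin.
apply: eq_bigr => a _; rewrite mulr_suml; apply: eq_bigr => p _.
rewrite big_ord_recl tnth0 -mulrA [in RHS](mulrC (cell_measure a)).
by congr (_ * (_ * _)); apply: eq_bigr => j _; rewrite tnthS.
Qed.

Lemma multi_integral_cell_fun m (c : {ffun 'I_m -> Q} -> R) :
  multi_integral nu (fun x : 'I_m -> S => (c [ffun j => q (x j)])%:E) =
  (\sum_p c p * \prod_j cell_measure (p j))%:E.
Proof.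
pose c' (p : m.-tuple Q) := c [ffun j => tnth p j].
transitivity (tuple_integral nu (fun t => (c' (map_tuple q t))%:E)).
  congr (tuple_integral _ _); apply/funext => t; congr (c _)%:E.
  by apply/ffunP => j; rewrite !ffunE tnth_map.
rewrite tuple_integral_cell_fun; congr EFin.
rewrite [RHS](reindex (fun p : m.-tuple Q => [ffun j => tnth p j])); last first.
  exists (fun f : {ffun 'I_m -> Q} => [tuple f j | j < m]) => [p _|f _].
    by apply: eq_from_tnth => j; rewrite tnth_mktuple ffunE.
  by apply/ffunP => j; rewrite ffunE tnth_mktuple.
by apply: eq_bigr => p _; congr (_ * _); apply: eq_bigr => j _; rewrite ffunE.
Qed.

End cell_functions.

(** Bounded convergence for iterated integrals, by induction on the number of
    variables. Requiring that the k-th function only depends on the cells of its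
    arguments makes each inner integral a function of the cell of the outer
    variable, so measurability is for free at every stage. *)
Lemma tuple_integral_bounded_cvg (Q : nat -> finType) (q : forall k, S -> Q k)
    m (c : forall k, m.-tuple (Q k) -> R) (f : m.-tuple S -> R) (C : R) :
  (forall k a, measurable (q k @^-1` [set a] : set (borel S))) ->
  (forall k t, 0 <= c k (map_tuple (q k) t) <= C) ->
  (forall t, c k (map_tuple (q k) t) @[k --> \oo] --> f t) ->
  tuple_integral nu (fun t => (c k (map_tuple (q k) t))%:E) @[k --> \oo]
    --> tuple_integral nu (fun t => (f t)%:E).
Proof.
move=> mq; elim: m c f => [|m IH] c f cC cf /=.
  by apply: cvg_EFin; [exact: nearW|exact: cf].
pose G k a := tuple_integral nu
  (fun t : m.-tuple S => (c k [tuple of a :: map_tuple (q k) t])%:E).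
have GE k : (fun x => tuple_integral nu
    (fun t : m.-tuple S => (c k (map_tuple (q k) [tuple of x :: t]))%:E)) = G k \o q k.
  apply/funext => x; congr (tuple_integral _ _); apply/funext => t.
  by rewrite map_tuple_cons.
have GC k x : (`|G k (q k x)| <= C%:E)%E.
  have c0C t : 0 <= c k [tuple of q k x :: map_tuple (q k) t] <= C.
    by rewrite -map_tuple_cons.
  have G0 : (0%:E <= G k (q k x))%E.
    rewrite -(tuple_integral_cst m 0); apply: le_tuple_integral => t.
    by rewrite lee_fin; have /andP[] := c0C t.
  rewrite (gee0_abs G0) -(tuple_integral_cst m C); apply: le_tuple_integral => t.
  by rewrite lee_fin; have /andP[] := c0C t.
have Gf x : G k (q k x) @[k --> \oo] -->
    tuple_integral nu (fun t : m.-tuple S => (f [tuple of x :: t])%:E).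
  apply: (IH (fun k p => c k [tuple of q k x :: p])
             (fun t => f [tuple of x :: t])) => [k t|t].
    by rewrite -map_tuple_cons.
  have := cf [tuple of x :: t].
  by under eq_fun do rewrite map_tuple_cons.
have mG k : measurable_fun [set: borel S] (G k \o q k) by exact: measurable_cell_fun.
under eq_fun do rewrite GE.
have [] // := @dominated_convergence _ _ _ nu setT measurableT
  (fun k => G k \o q k) _ (cst C%:E) mG _ (aeW nu (fun x _ => Gf x)).
- exact: emeasurable_fun_cvg mG (fun x _ => Gf x).
- exact: finite_measure_integrable_cst.
- by apply: aeW => x k _; exact: GC.
Qed.

End iterated_integrals.

(** * Convergence of V-statistics *)

Definition Vstat (R : realType) (S : Type) (m n : nat) (h : ('I_m -> S) -> R)
    (x : nat -> S) : R :=
  n%:R^-1 ^+ m * \sum_(i : {ffun 'I_m -> 'I_n}) h (fun j => x (i j)).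

Section Vstatistics.
Context (R : realType) (S : ptopologicalType).

Lemma le_Vstat m n (f g : ('I_m -> S) -> R) (x : nat -> S) :
  (forall y, f y <= g y) -> Vstat n f x <= Vstat n g x.
Proof.
move=> fg; apply: ler_wpM2l; last by apply: ler_sum.
by rewrite exprn_ge0// invr_ge0.
Qed.

(** Expand c as the sum over p of c p times a product over j of indicators of the
    cells p_j; the sum over all index maps i of such a product is the product
    over j of the sums over the single index i_j. *)
Lemma Vstat_cell_fun (Q : finType) (q : S -> Q) m n (c : {ffun 'I_m -> Q} -> R)
    (x : nat -> S) :
  Vstat n (fun y => c [ffun j => q (y j)]) x =
  \sum_p c p * \prod_j frequency R x (q @^-1` [set p j]) n.
Proof.
have cE (i : {ffun 'I_m -> 'I_n}) : c [ffun j => q (x (i j))] =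
    \sum_p c p * \prod_j \1_(q @^-1` [set p j]) (x (i j)).
  rewrite (bigD1 [ffun j => q (x (i j))])//= big1 ?mulr1 => [|j _]; last first.
    by rewrite indicE mem_set//= ffunE.
  rewrite big1 ?addr0// => p pq.
  have [j pj] : exists j, p j != q (x (i j)).
    apply/existsP; rewrite -negb_forall; apply: contra pq => /forallP pq.
    by apply/eqP/ffunP => j; rewrite ffunE; exact/eqP.
  rewrite (bigD1 j)//= indicE memNset ?mul0r ?mulr0//= => /esym/eqP.
  by rewrite (negPf pj).
rewrite /Vstat; under eq_bigr do rewrite cE.
rewrite exchange_big mulr_sumr; apply: eq_bigr => p _.
rewrite -mulr_sumr mulrCA; congr (_ * _).
rewrite -(bigA_distr_bigA (fun j (i : 'I_n) => \1_(q @^-1` [set p j]) (x i))).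
by rewrite /frequency big_split /= prodr_const card_ord.
Qed.

Variables (B : nat -> set S) (nu : probability (borel S) R) (x : nat -> S).
Hypothesis baseB : countable_base B.
Hypothesis freq_x : forall k a,
  frequency R x (cell B k @^-1` [set a]) n @[n --> \oo] -->
  fine (nu (cell B k @^-1` [set a])).

Lemma Vstat_cell_fun_cvg k m (c : {ffun 'I_m -> {ffun 'I_k -> bool}} -> R) :
  Vstat n (fun y => c [ffun j => cell B k (y j)]) x @[n --> \oo] -->
  \sum_p c p * \prod_j cell_measure nu (cell B k) (p j).
Proof.
under eq_fun do rewrite Vstat_cell_fun.
apply: cvg_big => [|p _]; first exact: add_continuous.
apply: cvgM; first exact: cvg_cst.
apply: cvg_big => //; last by move=> j _; exact: freq_x.
exact: mul_continuous.
Qed.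

Variables (m : nat) (h : power m S -> R) (M : R).
Hypothesis hM : forall y, `|h y| <= M.

Definition cell_values k (p : {ffun 'I_m -> {ffun 'I_k -> bool}}) : set R :=
  h @` [set y | forall j, cell B k (y j) = p j].

(** The oscillation of h over the product of the cells p_j. *)
Definition osc k p := sup (@cell_values k p) - inf (@cell_values k p).

Let cells k (y : 'I_m -> S) := [ffun j => cell B k (y j)].

Lemma has_ubound_cell_values k p : has_ubound (@cell_values k p).
Proof. by exists M => _ [y _ <-]; have := hM y; rewrite ler_norml => /andP[]. Qed.

Lemma has_lbound_cell_values k p : has_lbound (@cell_values k p).
Proof. by exists (- M) => _ [y _ <-]; have := hM y; rewrite ler_norml => /andP[]. Qed.

Lemma cell_values_self k y : cell_values (cells k y) (h y).
Proof. by exists y => //= j; rewrite ffunE. Qed.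

Lemma le_sup_cells k y : h y <= sup (cell_values (cells k y)).
Proof. by apply: ub_le_sup (cell_values_self k y); exact: has_ubound_cell_values. Qed.

Lemma ge_inf_cells k y : inf (cell_values (cells k y)) <= h y.
Proof. by apply: ge_inf (cell_values_self k y); exact: has_lbound_cell_values. Qed.

Lemma osc_cells_le k y (a b : R) :
  (forall z, (forall j, cell B k (z j) = cell B k (y j)) -> a <= h z <= b) ->
  osc (cells k y) <= b - a.
Proof.
move=> ab; have ne : cell_values (cells k y) !=set0 by exists (h y); exact: cell_values_self.
have {}ab z : (forall j, cell B k (z j) = cells k y j) -> a <= h z <= b.
  by move=> zy; apply: ab => j; rewrite zy ffunE.
by apply: lerB; [apply: ge_sup ne _|apply: lb_le_inf ne _] => _ [z /ab/andP[az zb] <-].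
Qed.

Lemma osc_cells_ge0 k y : 0 <= osc (cells k y).
Proof. by rewrite subr_ge0 (le_trans (ge_inf_cells k y) (le_sup_cells k y)). Qed.

Lemma osc_cells_nonincreasing y :
  {homo (fun k => osc (cells k y)) : k l / (k <= l)%N >-> l <= k}.
Proof.
move=> k l kl; apply: osc_cells_le => z zy.
have -> : cells k y = cells k z.
  by apply/ffunP => j; rewrite !ffunE; apply: cell_refine kl _; exact/esym/zy.
by rewrite ge_inf_cells le_sup_cells.
Qed.

Lemma osc_cells_le2M k y : osc (cells k y) <= 2 * M.
Proof.
have -> : 2 * M = M - - M by ring.
by apply: osc_cells_le => z _; rewrite -ler_norml.
Qed.

Lemma osc_cells_cvg y : osc (cells k y) @[k --> \oo] --> limn (fun k => osc (cells k y)).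
Proof.
apply: nonincreasing_is_cvgn; first exact: osc_cells_nonincreasing.
by exists 0 => _ [k _ <-]; exact: osc_cells_ge0.
Qed.

Lemma osc_cells_cvg0 y : {for y, continuous h} -> limn (fun k => osc (cells k y)) = 0.
Proof.
move=> hy; apply/cvg_lim => //; apply/cvgrPdist_le => e e0.
have e20 : 0 < e / 2 by rewrite divr_gt0.
have /cvgrPdist_le/(_ _ e20) : h z @[z --> y] --> h y := hy.
move=> /(nbhs_box baseB)[k ky]; exists k => // l /= kl.
rewrite sub0r normrN ger0_norm ?osc_cells_ge0//.
have -> : e = (h y + e / 2) - (h y - e / 2) by field.
apply: osc_cells_le => z zy.
have : `|h y - h z| <= e / 2 by apply: ky => j; apply: cell_refine kl _; exact: zy.
by rewrite ler_norml; lra.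
Qed.

(** Divided by 2 M + 1, which is positive even if h vanishes, the oscillation
    takes its values in [0, 1] and decreases with k to a limit f with
    0 <= f <= 1_D, where D is the set of discontinuities. So the iterated
    integral of f is 0, and the iterated integrals of the oscillations tend to
    it by bounded convergence. *)
Lemma multi_integral_osc_cvg0 :
  multi_integral nu (fun y => (\1_(discontinuity_set h) y)%:E) = 0%E ->
  multi_integral nu (fun y => (osc (cells k y) / (2 * M + 1))%:E) @[k --> \oo] --> 0%E.
Proof.
move=> D0; pose C := 2 * M + 1.
have C0 : 0 < C by have := le_trans (normr_ge0 _) (hM point); rewrite /C; lra.
pose f y := limn (fun k => osc (cells k y)) / C.
have f_ge0 y : 0 <= f y.
  rewrite divr_ge0 ?(ltW C0)//; apply: limr_ge; first exact: osc_cells_cvg.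
  by apply: nearW => k; exact: osc_cells_ge0.
have f_le y : f y <= \1_(discontinuity_set h) y.
  rewrite indicE; have [yD|yC] := boolP (y \in _); last first.
    rewrite /f osc_cells_cvg0 ?mul0r//.
    by apply: contrapT => ?; move/negP: yC; apply; rewrite inE.
  rewrite ler_pdivrMr// mul1r; apply: limr_le; first exact: osc_cells_cvg.
  by apply: nearW => k; rewrite (le_trans (osc_cells_le2M k y))// /C; lra.
have -> : 0%E = multi_integral nu (fun y => (f y)%:E).
  apply/eqP; rewrite eq_le; apply/andP; split.
    rewrite -[leLHS](tuple_integral_cst nu m 0).
    by apply: le_tuple_integral => t; rewrite lee_fin.
  by rewrite -D0; apply: le_tuple_integral => t; rewrite lee_fin.
pose c k (p : m.-tuple {ffun 'I_k -> bool}) : R := osc [ffun j => tnth p j] / C.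
have cE k (t : m.-tuple S) :
    c k (map_tuple (cell B k) t) = osc (cells k (tnth t)) / C.
  by congr (osc _ / _); apply/ffunP => j; rewrite !ffunE tnth_map.
have := @tuple_integral_bounded_cvg R S nu _ (fun k => cell B k) m c (fun t => f (tnth t)) 1.
under eq_fun do under eq_fun do rewrite cE; apply.
- by move=> k a; exact: measurable_cell.
- move=> k t; rewrite cE divr_ge0 ?osc_cells_ge0 ?(ltW C0)//= ler_pdivrMr// mul1r.
  by rewrite (le_trans (osc_cells_le2M k (tnth t)))// /C; lra.
- move=> t; under eq_fun do rewrite cE.
  by apply: cvgM; [exact: osc_cells_cvg|exact: cvg_cst].
Qed.

(** With lo k and up k the iterated integrals of the infimum and the supremum of h
    over products of cells, the integral of h and all limit points of the
    V-statistics of h lie between lo k and up k, whose difference is the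
    integral of the oscillation. *)
Lemma Vstat_cvg :
  multi_integral nu (fun y => (\1_(discontinuity_set h) y)%:E) = 0%E ->
  exists2 r : R, multi_integral nu (fun y => (h y)%:E) = r%:E &
    Vstat n h x @[n --> \oo] --> r.
Proof.
move=> /multi_integral_osc_cvg0; set C := 2 * M + 1 => osc0.
have C0 : 0 < C by have := le_trans (normr_ge0 _) (hM point); rewrite /C; lra.
pose J k (c : {ffun 'I_m -> {ffun 'I_k -> bool}} -> R) : R :=
  \sum_p c p * \prod_j cell_measure nu (cell B k) (p j).
have JE k c : multi_integral nu (fun y => (c (cells k y))%:E) = (J k c)%:E.
  exact: (multi_integral_cell_fun nu (measurable_cell baseB (k := k))).
pose lo k := J k (fun p => inf (cell_values p)).
pose up k := J k (fun p => sup (cell_values p)).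
have lo_le k : ((lo k)%:E <= multi_integral nu (fun y => (h y)%:E))%E.
  by rewrite -JE; apply: le_tuple_integral => t; rewrite lee_fin; exact: ge_inf_cells.
have le_up k : (multi_integral nu (fun y => (h y)%:E) <= (up k)%:E)%E.
  by rewrite -JE; apply: le_tuple_integral => t; rewrite lee_fin; exact: le_sup_cells.
have gap e : 0 < e -> exists k, up k - lo k <= e.
  move=> e0; move: osc0; under eq_fun do rewrite (JE _ (fun p => osc p / C)).
  move=> /fine_cvg/cvgrPdist_le/(_ (e / C) (divr_gt0 e0 C0))[k _ /(_ k (leqnn k))] /=.
  rewrite sub0r normrN => ke; exists k.
  have -> : up k - lo k = J k (fun p => osc p / C) * C.
    rewrite /up /lo /J mulr_suml -sumrB; apply: eq_bigr => p _.
    by rewrite -mulrBl mulrAC divfK ?gt_eqF.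
  by rewrite -ler_pdivlMr//; exact: le_trans (ler_norm _) ke.
have /fineK Ifin : multi_integral nu (fun y => (h y)%:E) \is a fin_num.
  apply/fin_real/andP; split.
    exact: lt_le_trans (ltNyr _) (lo_le 0%N).
  exact: le_lt_trans (le_up 0%N) (ltry _).
move: Ifin lo_le le_up; set r := fine _ => <- lo_le le_up; exists r => //.
apply/cvgrPdist_le => e e0.
have e20 : 0 < e / 2 by rewrite divr_gt0.
have [k ke] := gap _ e20.
have := lo_le k; have := le_up k; rewrite !lee_fin => rup lor.
have /cvgrPdist_le/(_ _ e20) nlo : Vstat n (fun y => inf (cell_values (cells k y))) x
    @[n --> \oo] --> lo k := @Vstat_cell_fun_cvg k m (fun p => inf (@cell_values k p)).
have /cvgrPdist_le/(_ _ e20) nup : Vstat n (fun y => sup (cell_values (cells k y))) x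
    @[n --> \oo] --> up k := @Vstat_cell_fun_cvg k m (fun p => sup (@cell_values k p)).
near=> n.
have : `|lo k - Vstat n (fun y => inf (cell_values (cells k y))) x| <= e / 2.
  by near: n; exact: nlo.
have : `|up k - Vstat n (fun y => sup (cell_values (cells k y))) x| <= e / 2.
  by near: n; exact: nup.
have : Vstat n (fun y => inf (cell_values (cells k y))) x <= Vstat n h x.
  by apply: le_Vstat => y; exact: ge_inf_cells.
have : Vstat n h x <= Vstat n (fun y => sup (cell_values (cells k y))) x.
  by apply: le_Vstat => y; exact: le_sup_cells.
by rewrite !ler_norml; lra.
Unshelve. all: by end_near. Qed.

End Vstatistics.

(** * Comparison of U- and V-statistics *)

Section increasing_maps.
Variables m n : nat.
Implicit Types f g : 'I_m -> 'I_n.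

Definition increasing f : bool :=
  [forall k : 'I_m, forall l : 'I_m, (k < l)%N ==> (f k < f l)%N].

Lemma increasingP f :
  reflect (forall k l : 'I_m, (k < l)%N -> (f k < f l)%N) (increasing f).
Proof.
apply: (iffP forallP) => [fi k l kl|fi k]; last by apply/forallP => l; apply/implyP/fi.
by have /forallP/(_ l)/implyP := fi k; exact.
Qed.

Lemma increasing_inj f : increasing f -> injective f.
Proof.
move=> /increasingP fi k l fkl; apply/val_inj.
by case: (ltngtP k l) => // /fi; rewrite fkl ltnn.
Qed.

Let le_ord : rel 'I_n := relpre (@nat_of_ord n) leq.

Let sorted_tuple f : sorted le_ord [tuple f j | j < m] =
  pairwise le_ord [tuple f j | j < m].
Proof. by rewrite sorted_pairwise// => a b c; exact: leq_trans. Qed.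

Lemma increasing_sorted f : increasing f -> sorted le_ord [tuple f j | j < m].
Proof.
move=> /increasingP fi; rewrite sorted_tuple /= pairwise_map.
apply: (@sub_pairwise _ (relpre (@nat_of_ord m) ltn)) => [k l kl|]; first exact/ltnW/fi.
by rewrite -pairwise_map val_enum_ord -sorted_pairwise ?iota_ltn_sorted//; exact: ltn_trans.
Qed.

Lemma sorted_increasing f : injective f -> sorted le_ord [tuple f j | j < m] ->
  increasing f.
Proof.
move=> finj; rewrite sorted_tuple => /(pairwiseP _) fi; apply/increasingP => k l kl.
rewrite ltn_neqAle; apply/andP; split.
  by apply/eqP => /val_inj/finj kl'; rewrite kl' ltnn in kl.
by have := fi (f k) k l; rewrite !inE !size_tuple !nth_mktuple; exact.
Qed.

(** Existence is given by sorting the values of f, uniqueness by the fact that two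
    sorted sequences that are permutations of each other are equal. *)
Lemma unique_increasing_perm f : injective f ->
  exists s0 : 'S_m, forall s : 'S_m, increasing (f \o s) = (s == s0).
Proof.
move=> finj; pose t := [tuple f j | j < m].
have tE (s : 'S_m) : [tuple tnth t (s j) | j < m] = [tuple (f \o s) j | j < m].
  by apply: eq_from_tnth => j; rewrite !tnth_mktuple.
have le_total : total le_ord by move=> a b; exact: leq_total.
have le_anti : antisymmetric le_ord.
  by move=> a b; rewrite /le_ord /= -eqn_leq => /eqP/val_inj.
have le_tr : transitive le_ord by move=> a b c; exact: leq_trans.
have /tuple_permP[s0 s0E] : perm_eq (sort le_ord t) t by rewrite perm_sort.
have inc_s0 : increasing (f \o s0).
  apply: sorted_increasing; first exact: inj_comp finj (@perm_inj _ s0).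
  by rewrite -tE -s0E sort_sorted.
exists s0 => s; apply/idP/eqP => [inc_s|-> //].
have perm_t (u : 'S_m) : perm_eq [tuple (f \o u) j | j < m] t.
  by apply/tuple_permP; exists u; rewrite tE.
have : [tuple (f \o s) j | j < m] = [tuple (f \o s0) j | j < m].
  apply: val_inj; apply: (sorted_eq le_tr le_anti).
  - exact: increasing_sorted.
  - exact: increasing_sorted.
  - by rewrite (permPl (perm_t s)) perm_sym perm_t.
move=> /(congr1 (fun u => tnth u)) e; apply/permP => j.
by have := congr1 (@^~ j) e; rewrite /= !tnth_mktuple => /finj.
Qed.

End increasing_maps.

Section U_versus_V.
Context (R : realType) (S : Type) (m : nat).
Variable h : ('I_m -> S) -> R.
Hypothesis h_sym : forall (s : 'S_m) y, h (fun k => y (s k)) = h y.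

(** Each injective map becomes increasing after exactly one permutation of its
    arguments. So the left-hand side is also a sum over pairs of an injective
    map i and a permutation s with i o s increasing; reindexing by i o s turns
    it, for each of the m! permutations s, into the sum over increasing maps. *)
Lemma sum_injective_symmetric n (x : nat -> S) :
  \sum_(i : {ffun 'I_m -> 'I_n} | injectiveb i) h (fun j => x (i j)) =
  m`!%:R * \sum_(i : {ffun 'I_m -> 'I_n} | increasing i) h (fun j => x (i j)).
Proof.
pose H (i : {ffun 'I_m -> 'I_n}) := h (fun j => x (i j)).
transitivity (\sum_(i : {ffun 'I_m -> 'I_n} | injectiveb i)
    \sum_(s : 'S_m | increasing (i \o s)) H i).
  apply: eq_bigr => i /injectiveP iinj.
  have [s0 s0E] := unique_increasing_perm iinj.
  by rewrite (big_pred1 s0).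
rewrite (exchange_big_dep predT)//=.
transitivity (\sum_(s : 'S_m) \sum_(i : {ffun 'I_m -> 'I_n} | increasing i) H i).
  apply: eq_bigr => s _.
  rewrite [RHS](reindex (fun i : {ffun 'I_m -> 'I_n} => [ffun j => i (s j)])); last first.
    exists (fun i : {ffun 'I_m -> 'I_n} => [ffun j => i ((s^-1)%g j)]) => i _;
      by apply/ffunP => j; rewrite !ffunE ?permKV ?permK.
  have iE (i : {ffun 'I_m -> 'I_n}) : [ffun j => i (s j)] =1 i \o s.
    by move=> j; rewrite ffunE.
  apply: eq_big => [i|i _]; last first.
    by rewrite /H -[LHS](h_sym s); congr h; apply/funext => j; rewrite ffunE.
  have -> : increasing [ffun j => i (s j)] = increasing (i \o s).
    by apply: eq_forallb => k; apply: eq_forallb => l; rewrite !iE.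
  rewrite andb_idl// => /increasing_inj is_inj; apply/injectiveP => a b iab.
  by apply: (can_inj (permKV s)); apply: is_inj; rewrite /= !permKV.
by rewrite sumr_const -cardsE cardsT card_Sn mulr_natl.
Qed.

Lemma Ustat_injective n (Omega : Type) (X : int -> Omega -> S) w :
  Ustat n h X w = (n ^_ m)%:R^-1 *
    \sum_(i : {ffun 'I_m -> 'I_n} | injectiveb i) h (fun j => X (i j).+1%:Z w).
Proof.
rewrite (sum_injective_symmetric n (fun i => X i.+1%:Z w)) -bin_ffact natrM invfM.
by rewrite -mulrA mulKf// pnatr_eq0 -lt0n fact_gt0.
Qed.

Variable M : R.
Hypothesis hM : forall y, `|h y| <= M.

(** The two averages differ by the weight of the injective maps and by the presence
    of the other maps. A proportion F / N of the N = n ^ m maps is injective, so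
    either effect is at most M (1 - F / N). *)
Lemma Ustat_Vstat_bound n (Omega : Type) (X : int -> Omega -> S) w :
  (m <= n)%N -> (0 < n)%N ->
  `|Ustat n h X w - Vstat n h (fun i => X i.+1%:Z w)| <= 2 * M * (1 - (n ^_ m)%:R / n%:R ^+ m).
Proof.
move=> mn n0.
pose H (i : {ffun 'I_m -> 'I_n}) := h (fun j => X (i j).+1%:Z w).
pose inj (i : {ffun 'I_m -> 'I_n}) := injectiveb i.
have card_inj : #|inj| = (n ^_ m)%N.
  by rewrite -cardsE card_inj_ffuns !card_ord.
have card_all : (#|inj| + #|predC inj| = n ^ m)%N.
  by rewrite cardC card_ffun !card_ord.
have sum_le (p : pred {ffun 'I_m -> 'I_n}) : `|\sum_(i | p i) H i| <= M * #|p|%:R.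
  rewrite (le_trans (ler_norm_sum _ _ _))// mulr_natr -sumr_const.
  by apply: ler_sum => i _; exact: hM.
pose a := \sum_(i | inj i) H i; pose b := \sum_(i | predC inj i) H i.
have Hab : \sum_i H i = a + b by exact: bigID.
rewrite Ustat_injective /Vstat [X in _ - _ * X]Hab [X in _ * X - _](_ : _ = a)//.
have := sum_le inj; have := sum_le (predC inj); rewrite -/a -/b.
have -> : #|predC inj|%:R = n%:R ^+ m - (n ^_ m)%:R :> R.
  by rewrite -natrX -card_all card_inj natrD addrC addKr.
rewrite card_inj; set F : R := (n ^_ m)%:R; rewrite exprVn; set N : R := n%:R ^+ m.
have F0 : 0 < F by rewrite ltr0n ffact_gt0.
have N0 : 0 < N by rewrite exprn_gt0// ltr0n.
have FN : F <= N by rewrite /F /N -natrX ler_nat -card_all card_inj leq_addr.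
move=> hb ha.
have -> : F^-1 * a - N^-1 * (a + b) = a * (F^-1 - N^-1) - b / N.
  by field; rewrite !gt_eqF.
rewrite (le_trans (ler_normB _ _))// !normrM.
have FN' : 0 <= F^-1 - N^-1 by rewrite subr_ge0 lef_pV2.
rewrite (ger0_norm FN') (gtr0_norm (_ : 0 < N^-1)) ?invr_gt0//.
have -> : 2 * M * (1 - F / N) = M * F * (F^-1 - N^-1) + M * (N - F) / N.
  by field; rewrite !gt_eqF.
by apply: lerD; apply: ler_wpM2r => //; rewrite invr_ge0 ltW.
Qed.

End U_versus_V.

Lemma cvg_ffact_exp (R : realType) (m : nat) :
  (n ^_ m)%:R / n%:R ^+ m @[n --> \oo] --> (1 : R).
Proof.
elim: m => [|m IH].
  by under eq_fun do rewrite ffactn0 expr0 divr1; exact: cvg_cst.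
have cvg1 : (n - m)%:R / n%:R @[n --> \oo] --> (1 : R).
  under eq_fun do rewrite mulrC.
  apply: cvg_mean => k; [exists 0%N|exists m] => n.
    rewrite addr0 mulrDr mulr1; apply: le_trans (_ : n%:R <= _).
      by rewrite ler_nat leq_subr.
    by rewrite lerDl mulr_ge0.
  rewrite mulrBr mulr1 lerBlDr -natrD; apply: le_trans (_ : n%:R <= _).
    by rewrite gerBl mulr_ge0.
  by rewrite ler_nat; lia.
under eq_fun do rewrite ffactnSr exprSr natrM invfM mulrACA.
by have := cvgM IH cvg1; rewrite mulr1; exact.
Qed.

(** * Strong law for U-statistics *)

Theorem theorem1p1 (R : realType) (d : measure_display) (Omega : measurableType d)
    (P : probability Omega R) (T T' : Omega -> Omega)
    (hT : mp_automorphism P T T')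
    (m : nat) (hm : (1 <= m)%N)
    (S : pmetricType R) (hS : separable S)
    (X0 : Omega -> S)
    (hX0 : measurable_fun [set: Omega] (X0 : Omega -> borel S))
    (X : int -> Omega -> S) (hX : forall i : int, X i = X0 \o iterz T T' i)
    (mu : Omega -> probability (borel S) R)
    (hmu : is_regular_cond_distribution P (invariant_sets T) X0 mu)
    (h : power m S -> R)
    (h_meas : measurable_fun [set: borel (power m S)] (h : borel (power m S) -> R))
    (h_sym : forall (s : 'S_m) (x : power m S), h (fun k => x (s k)) = h x)
    (h_bnd : exists M : R, forall x : power m S, `|h x| <= M)
    (h_disc : {ae P, forall w,
      multi_integral (mu w) (fun x => (\1_(discontinuity_set h) x)%:E) = 0%E}) :
  {ae P, forall w,
    (Ustat n h X w)%:E @[n --> \oo] --> multi_integral (mu w) (fun x => (h x)%:E)}.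
Proof.
have [_ _ mT _ PT] := hT.
have [B baseB] := separable_countable_base hS.
have [M hM] := h_bnd.
have freq : {ae P, forall w, forall (k : nat) (a : {ffun 'I_k -> bool}),
    frequency R (fun i => X i.+1%:Z w) (cell B k @^-1` [set a]) n @[n --> \oo] -->
    fine (mu w (cell B k @^-1` [set a]))}.
  apply: ae_foralln => k; apply: filter_forall => a.
  apply: filterS (ae_cvg_frequency mT PT hX0 hmu (measurable_cell baseB a)) => w.
  have -> : (fun i : nat => X i.+1%:Z w) = (fun i => X0 (iter i.+1 T w)).
    by apply/funext => i; rewrite hX.
  exact.
apply: filterS2 freq h_disc => w freq_w disc_w.
have [r -> Vr] := Vstat_cvg baseB freq_w hM disc_w.
apply: cvg_EFin; first exact: nearW.
pose V n := Vstat n h (fun i => X i.+1%:Z w).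
pose gap n : R := 2 * M * (1 - (n ^_ m)%:R / n%:R ^+ m).
have gap0 : gap n @[n --> \oo] --> 0.
  rewrite -[X in _ --> X](mulr0 (2 * M)) -[X in _ * X](subrr 1).
  apply: cvgM; first exact: cvg_cst.
  by apply: cvgB; [exact: cvg_cst|exact: cvg_ffact_exp].
apply: (@squeeze_cvgr _ _ _ _ (fun n => V n - gap n) (fun n => V n + gap n)).
- near=> n.
  have mn : (m <= n)%N by near: n; exact: nbhs_infty_ge.
  have := Ustat_Vstat_bound h_sym hM X w mn (leq_trans hm mn).
  by rewrite -/(V n) -/(gap n) ler_distl.
- by rewrite -[r]subr0; apply: cvgB.
- by rewrite -[r]addr0; apply: cvgD.
Unshelve. all: by end_near. Qed.
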